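(* Let $n > 1$ and let $\mathcal{S}$ be a semigroup in $M_n(\mathbb{C})$ with the property that $\sigma(S) \subset r_S \mathbb{T}$ for all $S \in \mathcal{S}$, where $r_S \geq 0$ (a real number depending on $S$). Then the semigroup $\mathcal{S}$ is simultaneously similar to a block triangular semigroup in which each diagonal block of size greater than $1$ is an irreducible semigroup of the form $\mathbb{R}_{\geq 0}\mathcal{S}_u$, where $\mathcal{S}_u$ is an irreducible semigroup of unitaries.
   Context: $M_n(\mathbb{C})$ is the algebra of all $n\times n$ complex matrices. A semigroup in $M_n(\mathbb{C})$ is a set of matrices closed under multiplication. $\sigma(S)$ denotes the spectrum (set of eigenvalues) of $S$, $\mathbb{T} = \{z \in \mathbb{C} : |z| = 1\}$ is the unit circle in the complex plane, and $\mathbb{R}_{\geq 0} = [0,+\infty)$. ''Simultaneously similar'' means that a single invertible $P \in M_n(\mathbb{C})$ is used, replacing $\mathcal{S}$ by $P^{-1}\mathcal{S}P$. For a semigroup of matrices all of which are block upper triangular with respect to one fixed partition of $n$, a diagonal block of the semigroup means the set of all matrices occurring as the $(i,i)$ block of members of the semigroup, for a fixed $i$; it is itself a semigroup of matrices. For $m>1$, a semigroup in $M_m(\mathbb{C})$ is irreducible if its members, viewed as linear transformations on $\mathbb{C}^m$, have no common invariant subspace other than $\{0\}$ and $\mathbb{C}^m$ (equivalently, the orbit of every nonzero vector spans $\mathbb{C}^m$). A semigroup of unitaries is a semigroup consisting of unitary matrices, and $\mathbb{R}_{\geq 0}\mathcal{S}_u = \{rU : r \in \mathbb{R}_{\geq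 0},\, U \in \mathcal{S}_u\}$.
   Formalization: ''Of the form R≥0 S_u'' is proved up to nonnegative real factors: R≥0·B = R≥0·S_u for each diagonal block B of size greater than 1; literal equality B = R≥0 S_u fails, e.g. for a finite irreducible group of unitaries, and is recovered when B is closed under nonnegative scalars. *)

(* Defs.v *)
From mathcomp Require Import all_boot all_order all_algebra.
From mathcomp Require Import classical_sets reals.
From mathcomp Require Import complex.

Set Implicit Arguments.
Unset Strict Implicit.
Unset Printing Implicit Defensive.

Import Order.TTheory GRing.Theory Num.Theory.

Local Open Scope classical_set_scope.
Local Open Scope ring_scope.
Local Open Scope complex_scope.

Section MatrixSemigroups.

Variable R : realType.

Definition matrix_semigroup n (S : set 'M[R[i]]_n) : Prop :=
  forall A B, S A -> S B -> S (A *m B).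

Definition spectrum n (A : 'M[R[i]]_n) : set R[i] :=
  [set z | eigenvalue A z].

Definition unit_circle : set R[i] := [set z | `|z| = 1].

(* Matrices act on column vectors. *)
Definition invariant_subspace n (S : set 'M[R[i]]_n)
    (W : {vspace 'cV[R[i]]_n}) : Prop :=
  forall A, S A -> forall v, v \in W -> A *m v \in W.

(* Only meant for 1 < n; for n <= 1 this holds of every S. *)
Definition irreducible n (S : set 'M[R[i]]_n) : Prop :=
  forall W : {vspace 'cV[R[i]]_n},
    invariant_subspace S W -> W = 0%VS \/ W = fullv.

Definition irreducible_semigroup n (S : set 'M[R[i]]_n) : Prop :=
  matrix_semigroup S /\ irreducible S.

Definition conjugate_by n (P : 'M[R[i]]_n) (S : set 'M[R[i]]_n) :
    set 'M[R[i]]_n :=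
  [set invmx P *m A *m P | A in S].

(* A partition of n is an equation n = \sum_i p i; since 'M_n and
   'M_(\sum_i p i) are different types, matrices are cast along it. *)
Definition cast_set n m (e : n = m) (S : set 'M[R[i]]_n) : set 'M[R[i]]_m :=
  [set castmx (e, e) A | A in S].

Definition block_upper_triangular k (p : 'I_k -> nat)
    (S : set 'M[R[i]]_(\sum_(i < k) p i)) : Prop :=
  forall A, S A -> forall i j : 'I_k, (j < i)%N -> submxblock A i j = 0.

Definition diagonal_block k (p : 'I_k -> nat)
    (S : set 'M[R[i]]_(\sum_(i < k) p i)) (i : 'I_k) : set 'M[R[i]]_(p i) :=
  [set submxblock A i i | A in S].

Definition nonneg_multiples n (S : set 'M[R[i]]_n) : set 'M[R[i]]_n :=
  [set B | exists (r : R) (A : 'M[R[i]]_n), [/\ 0 <= r, S A & B = r%:C *: A]].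

(* "S is of the form R_{>=0} Su", up to nonnegative real factors of the members
   of S. Taken literally, S = R_{>=0} Su would make every irreducible S that
   occurs as a diagonal block invariant under nonnegative scalars, which fails
   e.g. for a finite irreducible group of unitaries. When S is invariant under
   nonnegative scalars, the two are the same (nonneg_formE). In general it says
   that every member of S is r U with r >= 0 and U in Su, and that every U in Su
   is obtained in this way with r > 0 (nonneg_formP, whose
   hypothesis holds for unitaries). *)
Definition nonneg_form n (S Su : set 'M[R[i]]_n) : Prop :=
  nonneg_multiples S = nonneg_multiples Su.

Lemma nonneg_formE n (S Su : set 'M[R[i]]_n) :
  (forall (r : R) A, 0 <= r -> S A -> S (r%:C *: A)) ->
  nonneg_form S Su <-> S = nonneg_multiples Su.
Proof.
move=> hS; rewrite /nonneg_form.
suff -> : nonneg_multiples S = S by [].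
apply/seteqP; split=> [B [r [A [r0 SA ->]]]|A SA]; first exact: hS.
by exists 1, A; split; rewrite ?ler01 ?scale1r.
Qed.

Lemma nonneg_formP n (S Su : set 'M[R[i]]_n) :
  ~ Su 0 ->
  nonneg_form S Su <->
    S `<=` nonneg_multiples Su /\
    (forall U, Su U -> exists2 r : R, 0 < r & S (r%:C *: U)).
Proof.
move=> Su0; split=> [E|[sub sup]].
  split=> [A SA|U SuU].
    by rewrite -E; exists 1, A; split; rewrite ?ler01 ?scale1r.
  have : nonneg_multiples S U.
    by rewrite E; exists 1, U; split; rewrite ?ler01 ?scale1r.
  case=> r [A [r0 SA UE]].
  have rn0 : r != 0.
    by apply/eqP => rE; apply: Su0; move: SuU; rewrite UE rE scale0r.
  exists r^-1; first by rewrite invr_gt0 lt0r rn0.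
  by rewrite UE scalerA -rmorphM mulVf // scale1r.
apply/seteqP; split=> [B [r [A [r0 SA ->]]]|B [r [U [r0 SuU ->]]]].
  have [s [U [s0 SuU ->]]] := sub _ SA.
  by exists (r * s), U; split; rewrite ?mulr_ge0 ?scalerA ?rmorphM.
have [s s0 SsU] := sup _ SuU.
exists (r / s), (s%:C *: U); split=> //; first by rewrite divr_ge0 // ltW.
by rewrite scalerA -rmorphM divfK // gt_eqF.
Qed.

End MatrixSemigroups.

Arguments block_upper_triangular {R k} p S.
Arguments diagonal_block {R k} p S i.
Arguments unit_circle R : clear implicits.

(* Main.v *)
Require Import Defs.
From mathcomp Require Import all_boot all_order all_algebra.
From mathcomp Require Import ring lra boolp classical_sets reals.
From mathcomp Require Import topology normedtype derive.
From mathcomp Require Import complex.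

(** Triangularise first. A maximal flag of invariant subspaces puts the
    semigroup in block triangular form with irreducible diagonal blocks
    ([adapted_blocks], [diagonal_block_irreducible]). The eigenvalues of a
    diagonal block are eigenvalues of the whole matrix
    ([diagonal_block_eigenvalue]), so each diagonal block inherits the
    hypothesis on spectra, and it remains to treat an irreducible semigroup D
    of matrices of size m > 1.

    All eigenvalues of a member A of D have the same modulus r(A), hence
    |det A| = r(A)^m, and r is multiplicative on D. The trace form is
    nondegenerate on the algebra generated by D ([trace_form_nondegenerate]).
    Two consequences follow. The members with r(A) = 0 are orthogonal to D, so
    the only one is 0 ([singular_eq0]). The matrices A / r(A), for A nonzero,
    form an irreducible semigroup D1 on which the trace is bounded by m, and
    coordinates with respect to a basis in D1 are recovered from traces, so D1
    is bounded ([normalised_bounded]).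

    A bounded semigroup D1 with |det| = 1 is similar to a semigroup of
    unitaries ([unitarisable]). Consider the matrices X such that |X v| is at
    most the supremum of |v| and of the |A v|, for every vector v, with A in
    D1. They form a compact set stable under X -> X A. The determinant being
    strictly log-concave on positive definite matrices ([gram_midpoint]), all
    maximisers of |det X| have the same Gram matrix X^* X. Since X A is a
    maximiser whenever X is, X A X^-1 is unitary.

    Conjugating each diagonal block by its own X gives the theorem. *)

Import Order.TTheory GRing.Theory Num.Theory numFieldNormedType.Exports.
Local Open Scope classical_set_scope.
Local Open Scope ring_scope.
Local Open Scope complex_scope.
Local Open Scope sesquilinear_scope.

Set Implicit Arguments.
Unset Strict Implicit.
Unset Printing Implicit Defensive.

(** * Eigenvalues, traces and powers *)

Lemma trig_mxM (C : comNzRingType) m (A B : 'M[C]_m) :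
  is_trig_mx A -> is_trig_mx B ->
  is_trig_mx (A *m B) /\ forall i, (A *m B) i i = A i i * B i i.
Proof.
move=> /is_trig_mxP tA /is_trig_mxP tB; split.
  apply/is_trig_mxP => i j ij; rewrite mxE big1 // => l _.
  have [il|li] := ltnP i l; first by rewrite tA ?mul0r.
  by rewrite tB ?mulr0 // (leq_ltn_trans li).
move=> i; rewrite mxE (bigD1 i) //= big1 ?addr0 // => l li.
have [il|{}li'] := ltnP i l; first by rewrite tA ?mul0r.
by rewrite tB ?mulr0 // ltn_neqAle li' andbT.
Qed.

Lemma eigenvalue_det (F : fieldType) m (A : 'M[F]_m) z :
  eigenvalue A z <-> \det (A - z%:M) = 0.
Proof.
rewrite /eigenvalue /eigenspace kermx_eq0 row_free_unit unitmxE unitfE negbK.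
by split=> [/eqP|->].
Qed.

(** Schur triangularisation: the diagonal of a triangular matrix similar to
    [A] carries the determinant and all power traces of [A]. *)
Lemma eigenvalue_family (C : numClosedFieldType) m (A : 'M[C]_m) :
  exists d : 'I_m -> C,
    [/\ forall z, eigenvalue A z <-> exists i, z = d i,
        \det A = \prod_i d i &
        forall k, \tr (A ^+ k) = \sum_i d i ^+ k].
Proof.
case: m A => [|m] A.
  exists (fun=> 0); split; last 2 first.
  - by rewrite det_mx00 big_ord0.
  - by move=> k; rewrite /mxtrace !big_ord0.
  move=> z; split=> [/eigenvalueP [v _ /eqP []]|[[]//]].
  by apply/rowP => - [].
have [P /unitarymx_unit uP] := Schur A (ltn0Sn m).
rewrite /similar_to conjumx // => tD; set D := P *m A *m invmx P in tD.
have AE : A = invmx P *m D *m P.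
  by rewrite /D !mulmxA mulVmx // mul1mx -mulmxA mulVmx // mulmx1.
clearbody D; exists (fun i => D i i); split.
- move=> z; rewrite eigenvalue_det.
  have -> : A - z%:M = invmx P *m (D - z%:M) *m P.
    by rewrite mulmxBr mulmxBl -AE mul_mx_scalar -scalemxAl mulVmx // scalemx1.
  rewrite !det_mulmx mulrAC -det_mulmx mulVmx // det1 mul1r det_trig; last first.
    apply/is_trig_mxP => i j ij; rewrite !mxE (is_trig_mxP tD) //.
    by rewrite -val_eqE /= ltn_eqF // subr0.
  split=> [/eqP/prodf_eq0[i _]|[i ->]]; last first.
    by rewrite (bigD1 i) //= !mxE eqxx subrr mul0r.
  by rewrite !mxE eqxx mulr1n subr_eq0 => /eqP <-; exists i.
- rewrite AE !det_mulmx mulrAC -det_mulmx mulVmx // det1 mul1r.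
  exact: det_trig.
- move=> k.
  have [tr1 tr2] : is_trig_mx (D ^+ k) /\ forall i, (D ^+ k) i i = D i i ^+ k.
    elim: k => [|k [IH1 IH2]].
      by split=> [|i]; rewrite ?scalar_mx_is_trig ?mxE ?eqxx.
    rewrite exprS; have [H1 H2] := trig_mxM tD IH1.
    by split=> // i; rewrite H2 IH2 exprS.
  have -> : A ^+ k = invmx P *m D ^+ k *m P.
    elim: k {tr1 tr2} => [|k IH]; first by rewrite mulmx1 mulVmx.
    rewrite exprS IH {1}AE exprS -!mulmxE !mulmxA; congr (_ *m _ *m _).
    by rewrite mulmxK.
  by rewrite mxtrace_mulC mulmxA mulmxV // mul1mx; apply: eq_bigr => i _.
Qed.

(** Vanishing power sums kill every sum of [q (d j)] with [q] divisible by ['X].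
    If [d i] were nonzero, the [q] that also vanishes at all the other values
    of [d] would leave a nonzero multiple of [q (d i)], in characteristic 0. *)
Lemma power_sums_eq0 (C : numClosedFieldType) m (d : 'I_m -> C) :
  (forall k, (0 < k)%N -> \sum_i d i ^+ k = 0) -> forall i, d i = 0.
Proof.
move=> h i; apply/eqP/negPn/negP => di0.
have hq (q : {poly C}) : \sum_j ('X * q).[d j] = 0.
  under eq_bigr do rewrite mulrC hornerMX horner_coef mulr_suml.
  rewrite exchange_big big1 //= => k _.
  under eq_bigr do rewrite -mulrA -exprSr.
  by rewrite -mulr_sumr h // mulr0.
pose q : {poly C} := \prod_(j | d j != d i) ('X - (d j)%:P).
have q0 : q.[d i] != 0.
  rewrite horner_prod; apply/prodf_neq0 => j.
  by rewrite hornerXsubC subr_eq0 eq_sym.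
have := hq q; rewrite (bigID (fun j => d j == d i)) /= [X in _ + X]big1 => [|j ji].
  rewrite addr0 (eq_bigr (fun=> d i * q.[d i])) => [|j /eqP ->].
    rewrite sumr_const => /eqP; rewrite mulrn_eq0 mulf_eq0 (negPf di0) (negPf q0).
    rewrite !orbF => /eqP c0; have /card_gt0P: exists j, j \in [pred j | d j == d i].
      by exists i; rewrite inE.
    by rewrite lt0n => /eqP; apply; exact: c0.
  by rewrite hornerM hornerX.
by rewrite hornerM /q (bigD1 j) //= hornerM hornerXsubC subrr mul0r mulr0.
Qed.

Lemma eigenvalue_columnP (F : fieldType) m (A : 'M[F]_m) (z : F) :
  eigenvalue A z <-> exists2 y : 'cV_m, y != 0 & A *m y = z *: y.
Proof.
split=> [/eigenvalue_det dA|[y y0 Ay]].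
  have : eigenvalue A^T z.
    by apply/eigenvalue_det; rewrite -dA -[RHS]det_tr linearB /= tr_scalar_mx.
  move=> /eigenvalueP [v vA v0]; exists v^T; first by rewrite trmx_eq0.
  by rewrite -[A]trmxK -trmx_mul vA linearZ.
apply/eigenvalue_det/eqP/negPn/negP => dn0.
have uB : A - z%:M \in unitmx by rewrite unitmxE unitfE.
move/eqP: y0; apply.
by rewrite -(mulKmx uB y) mulmxBl Ay mul_scalar_mx subrr mulmx0.
Qed.

(** * The trace form of an irreducible algebra *)

(** A free sequence of members of [S] of the largest possible size. For a
    semigroup of matrices its span is the algebra generated by [S], with a
    basis taken from [S] itself, on which bounds known on [S] are available. *)
Lemma exists_free_span (K : fieldType) (V : vectType K) (S : set V) :
  exists s : seq V,
    [/\ free s, forall x, x \in s -> S x & forall x, S x -> x \in <<s>>%VS].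
Proof.
pose P k :=
  `[< exists s : seq V, [/\ free s, forall x, x \in s -> S x & size s = k] >].
have exP : exists k, P k.
  by exists 0%N; apply/asboolP; exists [::]; rewrite nil_free.
have leP k : P k -> (k <= \dim {:V})%N.
  move=> /asboolP[s [fs _ <-]].
  by rewrite -(eqP fs); apply: dimvS; apply: subvf.
have [k /asboolP[s [fs sS sk]] maxk] := ex_maxnP exP leP.
exists s; split=> // x Sx; apply/negPn/negP => xs.
have : P k.+1.
  apply/asboolP; exists (x :: s); split=> [|y|]; last by rewrite /= sk.
    by rewrite free_cons xs.
  by rewrite inE => /orP[/eqP ->//|/sS].
by move/maxk; rewrite ltnn.
Qed.

Section Algebra.
Variables (R : realType) (n : nat) (S : set 'M[R[i]]_n).

Lemma span_closedM (s : seq 'M[R[i]]_n) :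
  matrix_semigroup S -> (forall A, A \in s -> S A) ->
  (forall A, S A -> A \in <<s>>%VS) ->
  forall A B, A \in <<s>>%VS -> B \in <<s>>%VS -> A *m B \in <<s>>%VS.
Proof.
move=> sgS sS Ss.
have step1 A B : S A -> B \in <<s>>%VS -> A *m B \in <<s>>%VS.
  move=> SA Bs; pose f : 'Hom('M[R[i]]_n, 'M[R[i]]_n) := linfun (mulmx A).
  suff sub : (<<s>> <= f @^-1: <<s>>)%VS.
    by have := subvP sub _ Bs; rewrite -memv_preim lfunE.
  by apply/span_subvP => C Cs; rewrite -memv_preim lfunE; apply/Ss/sgS/sS.
move=> A B As Bs; pose f : 'Hom('M[R[i]]_n, 'M[R[i]]_n) := linfun (mulmxr B).
suff sub : (<<s>> <= f @^-1: <<s>>)%VS.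
  by have := subvP sub _ As; rewrite -memv_preim lfunE.
apply/span_subvP => C Cs; rewrite -memv_preim lfunE.
by apply: step1 => //; apply: sS.
Qed.

Variables (U : {vspace 'M[R[i]]_n}).
Hypotheses (n_gt1 : (1 < n)%N) (irrS : irreducible S).
Hypotheses (SU : forall A, S A -> A \in U)
           (UM : forall A B, A \in U -> B \in U -> A *m B \in U).

(** The orbit of [y] under [U] is invariant under [S]; were it zero, the line
    through [y] would be invariant, which [1 < n] forbids. *)
Lemma irreducible_cyclic (y : 'cV[R[i]]_n) : y != 0 ->
  forall x, exists2 A, A \in U & A *m y = x.
Proof.
move=> y0 x; pose f : 'Hom('M[R[i]]_n, 'cV[R[i]]_n) := linfun (mulmxr y).
have [|W0|Wf] := irrS (W := (f @: U)%VS).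
- move=> B SB _ /memv_imgP [A AU ->]; rewrite lfunE /= mulmxA.
  apply/memv_imgP; exists (B *m A); rewrite ?lfunE //.
  by apply: UM => //; apply: SU.
- have Ay A : S A -> A *m y = 0.
    move=> SA; apply/eqP; rewrite -memv0 -W0.
    by apply/memv_imgP; exists A; rewrite ?lfunE //; apply: SU.
  have [|/eqP|yf] := irrS (W := <[y]>%VS).
  + by move=> A SA _ /vlineP [c ->]; rewrite -scalemxAr Ay // scaler0 mem0v.
  + by rewrite -dimv_eq0 dim_vline y0.
  + have : \dim <[y]>%VS = n by rewrite yf dimvf /dim /= muln1.
    rewrite dim_vline y0 => n1; exfalso; move: n_gt1.
    by rewrite -[in X in X -> _]n1.
- have : x \in (f @: U)%VS by rewrite Wf memvf.
  by move=> /memv_imgP [A AU ->]; exists A; rewrite // lfunE.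
Qed.

(** If [T x] is nonzero, irreducibility gives [A] in [U] with [A T x = x], so
    that [T A] fixes [T x] and has the eigenvalue 1. But every positive
    power of [T A] has the form [T A'] with [A'] in [U], hence trace 0, so
    [T A] is nilpotent. *)
Lemma trace_form_nondegenerate (T : 'M[R[i]]_n) :
  T \in U -> (forall A, A \in U -> \tr (T *m A) = 0) -> T = 0.
Proof.
move=> TU trT; apply/eqP/negPn/negP => T0.
have [x Tx0] : exists x : 'cV[R[i]]_n, T *m x != 0.
  apply/not_existsP => h; move/negP: T0; apply; apply/eqP/matrixP => i j.
  have /negP := h (delta_mx j 0); rewrite negbK -colE => /eqP /matrixP /(_ i 0).
  by rewrite !mxE.
have [A AU ATx] := irreducible_cyclic Tx0 x.
pose M := T *m A.
have MU k : A *m M ^+ k \in U.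
  elim: k => [|k IH]; first by rewrite mulmx1.
  by rewrite exprSr -mulmxE mulmxA; apply: UM => //; apply: UM.
have [d [eigM _ trM]] := eigenvalue_family M.
have d0 : forall i, d i = 0.
  apply: power_sums_eq0 => - [//|k] _; rewrite -trM exprS -mulmxE -mulmxA.
  exact: trT.
have eig1 : eigenvalue M 1.
  by apply/eigenvalue_columnP; exists (T *m x); rewrite // scale1r -mulmxA ATx.
have [j] := (eigM 1).1 eig1; by rewrite d0 => /eqP; rewrite oner_eq0.
Qed.

End Algebra.

(** * Normalisation by the spectral radius *)

(** With a basis of the algebra generated by [S] chosen in [S], the coordinates
    of [A] solve a linear system whose matrix [G] is the Gram matrix of the
    trace form, invertible by nondegeneracy, and whose right-hand side consists
    of traces of members of [S]. *)
Lemma bounded_trace_bounded (R : realType) n (S : set 'M[R[i]]_n) (c : R[i]) :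
  (1 < n)%N -> irreducible_semigroup S -> (forall A, S A -> `|\tr A| <= c) ->
  forall i j, exists M : R[i], forall A, S A -> `|A i j| <= M.
Proof.
move=> n1 [sgS irrS] trS i j.
have [s [fs sS Ss]] := exists_free_span S.
have UM := span_closedM sgS sS Ss.
pose G := \matrix_(k < size s, l < size s) \tr (s`_k *m s`_l).
have uG : G \in unitmx.
  rewrite -row_free_unit; apply: inj_row_free => v vG.
  pose T := \sum_k v 0 k *: s`_k.
  have TU : T \in <<s>>%VS.
    by apply: rpred_sum => k _; apply/rpredZ/memv_span/mem_nth.
  have T0 : T = 0.
    apply: (trace_form_nondegenerate n1 irrS Ss UM TU) => A.
    move=> /(coord_span (X := in_tuple s)) ->.
    rewrite mulmx_sumr linear_sum big1 // => l _; rewrite -scalemxAr linearZ /=.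
    move/rowP/(_ l): vG; rewrite !mxE => vG.
    suff -> : \tr (T *m s`_l) = 0 by rewrite mulr0.
    rewrite -[RHS]vG mulmx_suml linear_sum; apply: eq_bigr => k _ /=.
    by rewrite -scalemxAl linearZ mxE.
  apply/rowP => k; rewrite mxE.
  by have /freeP := fs : free (in_tuple s); apply.
exists (\sum_k (\sum_l c * `|invmx G l k|) * `|(s`_k : 'M_n) i j|) => A SA.
pose a := \row_k coord (in_tuple s) k A.
pose t := \row_(l < size s) \tr (A *m s`_l).
have AE : A = \sum_k a 0 k *: s`_k.
  rewrite {1}(coord_span (X := in_tuple s) (Ss _ SA)).
  by apply: eq_bigr => k _; rewrite mxE.
have tE : t = a *m G.
  apply/rowP => l; rewrite !mxE {1}AE mulmx_suml linear_sum; apply: eq_bigr => k _ /=.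
  by rewrite -scalemxAl linearZ mxE [in RHS]mxE.
have aE : a = t *m invmx G by rewrite tE mulmxK.
(* the bound is read off the entries of [a = t G^-1] *)
rewrite AE summxE (le_trans (ler_norm_sum _ _ _)) //; apply: ler_sum => k _.
rewrite mxE normrM ler_wpM2r // aE mxE (le_trans (ler_norm_sum _ _ _)) //.
apply: ler_sum => l _; rewrite normrM ler_wpM2r // mxE trS //.
by apply: sgS => //; apply/sS/mem_nth.
Qed.

Section Normalisation.
Variables (R : realType) (n : nat) (S : set 'M[R[i]]_n).
Hypotheses (n_gt1 : (1 < n)%N) (irrS : irreducible_semigroup S).
Hypothesis (specS : forall A, S A ->
  exists2 r : R, 0 <= r & spectrum A `<=` [set r%:C * z | z in unit_circle R]).

(** On [S] the modulus of the determinant is the n-th power of the spectral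
    radius; this makes the spectral radius multiplicative on [S]. *)
Lemma circular_family A : S A ->
  exists (r : R) (d : 'I_n -> R[i]),
    [/\ 0 <= r, forall j, `|d j| = r%:C, `|\det A| = r%:C ^+ n & \tr A = \sum_j d j].
Proof.
move=> SA; have [r r0 spA] := specS SA.
have [d [eigA detA trA]] := eigenvalue_family A.
have dr j : `|d j| = r%:C.
  have /spA [z z1 <-] : spectrum A (d j) by apply/eigA; exists j.
  by rewrite normrM (z1 : `|z| = 1) mulr1 ger0_norm // ler0c.
exists r, d; split=> //.
  by rewrite detA normr_prod (eq_bigr (fun=> r%:C)) // prodr_const card_ord.
by have := trA 1%N; rewrite expr1 => ->.
Qed.

(** A singular member [A] is nilpotent, and so is [A B] for every [B] in [S],
    since it is singular too: [A] is in the radical of the trace form. *)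
Lemma singular_eq0 A : S A -> \det A = 0 -> A = 0.
Proof.
have [sgS irr] := irrS.
move=> SA detA; have [s [fs sS Ss]] := exists_free_span S.
apply: (trace_form_nondegenerate n_gt1 irr Ss (span_closedM sgS sS Ss) (Ss _ SA)).
move=> B /(coord_span (X := in_tuple s)) ->.
rewrite mulmx_sumr linear_sum big1 // => l _; rewrite -scalemxAr linearZ /=.
have Ssl : S s`_l by apply/sS/mem_nth.
have [r [d [_ dr]]] := circular_family (sgS _ _ SA Ssl).
rewrite det_mulmx detA mul0r normr0 => /esym/eqP.
rewrite expf_eq0 => /andP [_ /eqP r0] ->.
by rewrite big1 ?mulr0 // => j _; apply/eqP; rewrite -normr_eq0 dr r0.
Qed.

(** The members of [S] of nonzero spectral radius, divided by it. The determinant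
    condition is used because it is visibly stable under products. *)
Definition normalised : set 'M[R[i]]_n :=
  [set A | `|\det A| = 1 /\ exists2 r : R, 0 < r & S (r%:C *: A)].

Lemma normalisedP A : S A ->
  A = 0 \/ exists (r : R) B, [/\ 0 < r, normalised B & A = r%:C *: B].
Proof.
move=> SA; have [|d0] := eqVneq (\det A) 0; first by left; apply: singular_eq0.
right; have [r [d [r0 _ detA _]]] := circular_family SA.
have rn0 : r%:C != 0.
  apply: contra_neq d0 => r0'; apply/eqP; rewrite -normr_eq0 detA r0' expr0n.
  by case: (n) n_gt1.
have rp : 0 < r by rewrite lt0r r0 andbT; apply: contra_neq rn0 => ->.
have AE : A = r%:C *: (r%:C^-1 *: A) by rewrite scalerA mulfV // scale1r.
exists r, (r%:C^-1 *: A); split=> //; split; last by exists r; rewrite -?AE.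
rewrite detZ normrM detA normrX normfV ger0_norm ?ler0c //.
by rewrite -exprMn mulVf // expr1n.
Qed.

Lemma normalised_semigroup : matrix_semigroup normalised.
Proof.
move=> A B [dA [r r0 SA]] [dB [s s0 SB]]; split.
  by rewrite det_mulmx normrM dA dB mulr1.
exists (r * s); first exact: mulr_gt0.
rewrite rmorphM -scalerA.
by have := irrS.1 _ _ SA SB; rewrite -scalemxAl -scalemxAr.
Qed.

Lemma normalised_irreducible : irreducible normalised.
Proof.
move=> W invW; apply: irrS.2 => A /normalisedP [-> v _|[r [B [_ NB ->]]] v vW].
  by rewrite mul0mx mem0v.
by rewrite -scalemxAl rpredZ //; apply: invW.
Qed.

(** The eigenvalues have modulus 1, so the traces have modulus at most [n]. *)
Lemma normalised_bounded i j :
  exists M : R[i], forall A, normalised A -> `|A i j| <= M.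
Proof.
apply: (@bounded_trace_bounded _ _ _ n%:R) => //.
  by split; [exact: normalised_semigroup|exact: normalised_irreducible].
move=> A [detA [r r0 SA]].
have [s [d [s0 ds]]] := circular_family SA.
have rC0 : 0 < r%:C by rewrite ltcR.
rewrite detZ normrM detA mulr1 normrX gtr0_norm // => /eqP.
rewrite (eqrXn2 (ltnW n_gt1) (ltW rC0)) ?ler0c // => /eqP rs.
rewrite linearZ /= => trA.
rewrite -(ler_pM2l rC0) -{1}(gtr0_norm rC0) -normrM trA.
rewrite (le_trans (ler_norm_sum _ _ _)) //.
rewrite (eq_bigr (fun=> r%:C)); last by move=> k _; rewrite ds.
by rewrite sumr_const card_ord mulr_natr.
Qed.

End Normalisation.

(** * Gram matrices and log-concavity of the determinant *)

(** Each factor [((1 + l j) / 2) ^+ 2 / l j] is at least 1, with equality only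
    if [l j = 1]: strict concavity of the logarithm, at 1 and [l j]. *)
Lemma prod_mid_gt1 (C : numClosedFieldType) m (l : 'I_m -> C) :
  (forall j, 0 <= l j) -> \prod_j l j = 1 -> (exists j, l j != 1) ->
  1 < \prod_j ((1 + l j) / 2).
Proof.
move=> l0 pl [j0 lj0].
have lp j : 0 < l j.
  rewrite lt0r l0 andbT; apply/eqP => lj.
  by move/eqP: pl; rewrite (bigD1 j) //= lj mul0r eq_sym oner_eq0.
have gap j : ((1 + l j) / 2) ^+ 2 - l j = ((1 - l j) / 2) ^+ 2 by field.
have realj j : (1 - l j) / 2 \is Num.real.
  by rewrite rpredM ?rpredV ?rpredB ?ger0_real ?ltW.
have ge1 j : 1 <= ((1 + l j) / 2) ^+ 2 / l j.
  by rewrite ler_pdivlMr // mul1r -subr_ge0 gap real_exprn_even_ge0.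
have m0 j : 0 <= (1 + l j) / 2 by rewrite divr_ge0 // addr_ge0.
rewrite -(expr_gt1 (n := 2)) //; last by apply: prodr_ge0 => j _.
have -> : (\prod_j ((1 + l j) / 2)) ^+ 2 =
    \prod_j (((1 + l j) / 2) ^+ 2 / l j).
  by rewrite [RHS]prodf_div pl divr1 prodrXl.
rewrite (bigD1 j0) //=.
apply: (@lt_le_trans _ _ (((1 + l j0) / 2) ^+ 2 / l j0)).
  rewrite ltr_pdivlMr // mul1r -subr_gt0 gap real_exprn_even_gt0 //=.
  by rewrite mulf_neq0 ?invr_eq0 ?pnatr_eq0 // subr_eq0 eq_sym.
rewrite ler_peMr //; first exact: le_trans (ge1 j0).
by elim/big_rec: _ => // j x _ x1; rewrite -[leLHS]mulr1 ler_pM.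
Qed.

Lemma trmxC_mul (C : numClosedFieldType) m n p
    (A : 'M[C]_(m, n)) (B : 'M[C]_(n, p)) : (A *m B) ^t* = B ^t* *m A ^t*.
Proof. by rewrite trmx_mul map_mxM. Qed.

Lemma gram_diag_ge0 (C : numClosedFieldType) m n (A : 'M[C]_(m, n)) j :
  (A ^t* *m A) j j = \sum_k `|A k j| ^+ 2.
Proof. by rewrite mxE; apply: eq_bigr => k _; rewrite !mxE mulrC normCK. Qed.

Lemma norm_det_gram (C : numClosedFieldType) m (A : 'M[C]_m) :
  `|\det A| ^+ 2 = \det (A ^t* *m A).
Proof. by rewrite det_mulmx det_map_mx det_tr mulrC normCK. Qed.

(** Strict log-concavity of the determinant on positive definite matrices, for
    the midpoint of [X ^t* *m X] and [Y ^t* *m Y]. With [Y = W X] and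
    [W ^t* *m W] diagonalised as [V ^t* *m diag l *m V], the midpoint is the
    Gram matrix of [diag (sqrt ((1 + l) / 2)) *m V *m X]. *)
Lemma gram_midpoint (C : numClosedFieldType) m (X Y : 'M[C]_m) :
  X \in unitmx -> `|\det Y| = `|\det X| ->
  Y ^t* *m Y = X ^t* *m X \/
  exists Z, Z ^t* *m Z + Z ^t* *m Z = X ^t* *m X + Y ^t* *m Y
            /\ `|\det X| < `|\det Z|.
Proof.
move=> uX dY; have [W YE] : exists W, Y = W *m X.
  by exists (Y *m invmx X); rewrite mulmxKV.
have dX0 : 0 < `|\det X| by rewrite normr_gt0 -unitfE -unitmxE.
have dW : `|\det W| = 1.
  apply: (mulIf (lt0r_neq0 dX0)).
  by rewrite -normrM -det_mulmx -YE mul1r.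
pose H := W ^t* *m W.
have /hermitian_normalmx /orthomx_spectralP HE : H \is hermsymmx.
  apply/is_hermitianmxP; rewrite expr0 scale1r /H. by rewrite trmxC_mul trmxCK.
have uV := spectral_unitarymx H.
move: (spectralmx H) (spectral_diag H) uV HE => V l uV.
rewrite (invmx_unitary uV) => HE.
have VV : V *m V ^t* = 1%:M by apply/unitarymxP.
have VV' : V ^t* *m V = 1%:M by apply: mulmx1C.
have lE : diag_mx l = (W *m V ^t*) ^t* *m (W *m V ^t*).
  rewrite trmxC_mul trmxCK !mulmxA -(mulmxA V) -/H HE !mulmxA VV mul1mx.
  by rewrite -mulmxA VV mulmx1.
have l0 j : 0 <= l 0 j.
  have := gram_diag_ge0 (W *m V ^t*) j; rewrite -lE mxE eqxx mulr1n => ->.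
  by apply: sumr_ge0 => k _; rewrite exprn_ge0.
have pl : \prod_j l 0 j = 1.
  rewrite -det_diag lE -norm_det_gram det_mulmx normrM dW mul1r norm_det_gram.
  by rewrite trmxCK VV det1.
have [/existsP l1|/existsPn l1] := boolP [exists j, l 0 j != 1]; last first.
  left; suff H1 : H = 1%:M.
    by rewrite YE trmxC_mul mulmxA -(mulmxA (X ^t*)) -/H H1 mulmx1.
  rewrite HE; suff -> : diag_mx l = 1%:M by rewrite mulmx1.
  apply/matrixP => i j; rewrite !mxE.
  by have := l1 i; rewrite negbK => /eqP ->.
right; pose mid j := (1 + l 0 j) / 2.
have mid0 j : 0 <= mid j by rewrite divr_ge0 // addr_ge0.
pose D := diag_mx (\row_j sqrtC (mid j)).
have DD : D ^t* *m D = diag_mx (\row_j mid j).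
  rewrite /D tr_diag_mx map_diag_mx mulmx_diag; congr diag_mx.
  apply/rowP => j; rewrite !mxE -[RHS]sqrtCK expr2; congr (_ * _).
  by apply/CrealP; rewrite ger0_real // sqrtC_ge0.
have sandwich (E : 'M[C]_m) :
    (V *m X) ^t* *m E *m (V *m X) = X ^t* *m (V ^t* *m E *m V) *m X.
  by rewrite trmxC_mul !mulmxA.
exists (D *m (V *m X)); split.
  rewrite trmxC_mul !mulmxA -(mulmxA _ (D ^t*)) DD -mulmxA -mulmxDl -mulmxDr.
  have -> : Y ^t* *m Y = (V *m X) ^t* *m diag_mx l *m (V *m X).
    by rewrite sandwich -HE YE trmxC_mul !mulmxA.
  have -> : X ^t* *m X = (V *m X) ^t* *m 1%:M *m (V *m X).
    by rewrite sandwich mulmx1 VV' mulmx1.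
  rewrite -mulmxDl -mulmxDr.
  congr (_ *m _ *m _); apply/matrixP => i j; rewrite !mxE.
  by case: eqP => _; rewrite ?mulr0n ?addr0 // !mulr1n /mid; field.
have dV : `|\det V| = 1.
  by apply/eqP; rewrite -(@pexpr_eq1 _ _ 2) // norm_det_gram VV' det1.
rewrite !det_mulmx !normrM dV mul1r ltr_pMl // -(expr_gt1 (n := 2)) //.
rewrite norm_det_gram DD det_diag; under eq_bigr do rewrite mxE.
exact: prod_mid_gt1.
Qed.

(** * Continuity of complex polynomial expressions *)

Section ComplexContinuity.
Variables (R : realType) (T : topologicalType).

(** Continuity is asked of the two real components, so that only the topology
    of the reals is involved. *)
Definition ccontinuous (g : T -> R[i]) : Prop :=
  continuous (fun x => complex.Re (g x)) /\ continuous (fun x => complex.Im (g x)).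

Lemma ccontinuous_cst c : ccontinuous (fun=> c).
Proof. by split; apply: cst_continuous. Qed.

Lemma ccontinuousD g h : ccontinuous g -> ccontinuous h ->
  ccontinuous (fun x => g x + h x).
Proof.
move=> [gR gI] [hR hI]; split=> x.
  have -> : (fun x => complex.Re (g x + h x)) =
            (fun x => complex.Re (g x) + complex.Re (h x)).
    by apply/funext => y; rewrite raddfD.
  by apply: cvgD; [exact: gR|exact: hR].
have -> : (fun x => complex.Im (g x + h x)) =
          (fun x => complex.Im (g x) + complex.Im (h x)).
  by apply/funext => y; rewrite raddfD.
by apply: cvgD; [exact: gI|exact: hI].
Qed.

Lemma ccontinuousM g h : ccontinuous g -> ccontinuous h ->
  ccontinuous (fun x => g x * h x).
Proof.
move=> [gR gI] [hR hI]; split=> x.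
  have -> : (fun x => complex.Re (g x * h x)) =
            (fun x => complex.Re (g x) * complex.Re (h x)
                    - complex.Im (g x) * complex.Im (h x)).
    by apply/funext => y; case: (g y) (h y) => a b [c d].
  by apply: cvgB; apply: cvgM;
    [exact: gR|exact: hR|exact: gI|exact: hI].
have -> : (fun x => complex.Im (g x * h x)) =
          (fun x => complex.Re (g x) * complex.Im (h x)
                  + complex.Im (g x) * complex.Re (h x)).
  by apply/funext => y; case: (g y) (h y) => a b [c d].
by apply: cvgD; apply: cvgM; [exact: gR|exact: hI|exact: gI|exact: hR].
Qed.

Lemma ccontinuous_sum (I : Type) (r : seq I) (P : pred I)
    (g : I -> T -> R[i]) : (forall k, ccontinuous (g k)) ->
  ccontinuous (fun x => \sum_(k <- r | P k) g k x).
Proof.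
move=> gc; elim: r => [|k r IH].
  rewrite (_ : (fun x => _) = fun=> 0); first exact: ccontinuous_cst.
  by apply/funext => x; rewrite big_nil.
case Pk : (P k).
  rewrite (_ : (fun x => _) = fun x => g k x + \sum_(l <- r | P l) g l x).
    exact: ccontinuousD.
  by apply/funext => x; rewrite big_cons Pk.
rewrite (_ : (fun x => _) = fun x => \sum_(l <- r | P l) g l x) //.
by apply/funext => x; rewrite big_cons Pk.
Qed.

Lemma ccontinuous_prod (I : Type) (r : seq I) (g : I -> T -> R[i]) :
  (forall k, ccontinuous (g k)) -> ccontinuous (fun x => \prod_(k <- r) g k x).
Proof.
move=> gc; elim: r => [|k r IH].
  rewrite (_ : (fun x => _) = fun=> 1); first exact: ccontinuous_cst.
  by apply/funext => x; rewrite big_nil.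
rewrite (_ : (fun x => _) = fun x => g k x * \prod_(l <- r) g l x).
  exact: ccontinuousM.
by apply/funext => x; rewrite big_cons.
Qed.

Lemma ccontinuous_det n (X : T -> 'M[R[i]]_n) :
  (forall i j, ccontinuous (fun x => X x i j)) ->
  ccontinuous (fun x => \det (X x)).
Proof.
move=> Xc; rewrite /determinant; apply: ccontinuous_sum => s.
by apply: ccontinuousM; [exact: ccontinuous_cst|exact: ccontinuous_prod].
Qed.

Lemma continuous_sqr_norm g :
  ccontinuous g -> continuous (fun x => complex.Re (`|g x| ^+ 2)).
Proof.
move=> [gR gI] x.
rewrite (_ : (fun x => _) = fun x =>
    complex.Re (g x) * complex.Re (g x) + complex.Im (g x) * complex.Im (g x)).
  by apply: cvgD; apply: cvgM;
    [exact: gR|exact: gR|exact: gI|exact: gI].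
by apply/funext => y; rewrite -add_Re2_Im2 /= !expr2.
Qed.

End ComplexContinuity.

(** * Bounded semigroups are unitarisable *)

Definition sqnorm (R : realType) n (v : 'cV[R[i]]_n) : R :=
  \sum_k complex.Re (`|v k 0| ^+ 2).

Lemma sqnormE (R : realType) n (v : 'cV[R[i]]_n) :
  (sqnorm v)%:C = (v ^t* *m v) 0 0.
Proof.
rewrite gram_diag_ge0 rmorph_sum; apply: eq_bigr => k _.
by apply: RRe_real; rewrite rpredX // normr_real.
Qed.

Section Unitarisation.
Variables (R : realType) (n : nat) (S : set 'M[R[i]]_n).
Hypotheses (sgS : matrix_semigroup S) (detS : forall A, S A -> `|\det A| = 1).
Hypothesis bndS : forall i j, exists M : R[i], forall A, S A -> `|A i j| <= M.

(** [X v] is at most the supremum of the norms of [A v], for [A] in [S] or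
    [A = 1]. The upper bounds [M] stand for this supremum. In terms of
    [X ^t* *m X] these matrices form a compact convex set, stable under
    right multiplication of [X] by [S]. *)
Definition dominated : set 'M[R[i]]_n :=
  [set X | forall v (M : R), sqnorm v <= M ->
     (forall A, S A -> sqnorm (A *m v) <= M) -> sqnorm (X *m v) <= M].

Lemma dominated1 : dominated 1%:M.
Proof. by move=> v M vM _; rewrite mul1mx. Qed.

Lemma dominatedM X A : dominated X -> S A -> dominated (X *m A).
Proof.
move=> KX SA v M vM SM; rewrite -mulmxA; apply: KX => [|B SB]; first exact: SM.
by rewrite mulmxA; apply/SM/sgS.
Qed.

Lemma dominated_midpoint X Y Z : dominated X -> dominated Y ->
  Z ^t* *m Z + Z ^t* *m Z = X ^t* *m X + Y ^t* *m Y -> dominated Z.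
Proof.
move=> KX KY ZE v M vM SM; have XM := KX v M vM SM; have YM := KY v M vM SM.
have form (W : 'M[R[i]]_n) :
    (sqnorm (W *m v))%:C = (v ^t* *m (W ^t* *m W) *m v) 0 0.
  by rewrite sqnormE trmxC_mul !mulmxA.
have : sqnorm (Z *m v) + sqnorm (Z *m v) = sqnorm (X *m v) + sqnorm (Y *m v).
  apply: complexI; rewrite !rmorphD /= !form.
  have add (B C : 'M[R[i]]_n) : (v ^t* *m B *m v) 0 0 + (v ^t* *m C *m v) 0 0
      = (v ^t* *m (B + C) *m v) 0 0 by rewrite mulmxDr mulmxDl [RHS]mxE.
  by rewrite !add ZE.
by move=> E; lra.
Qed.

Lemma dominated_bounded i j : exists c : R, forall X, dominated X ->
  complex.Re (`|X i j| ^+ 2) <= c.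
Proof.
have [b bP] := choice (fun k => bndS k j).
pose e : 'cV[R[i]]_n := delta_mx j 0.
have pos (z : R[i]) : 0 <= complex.Re (`|z| ^+ 2).
  by rewrite -add_Re2_Im2 /= addr_ge0 ?sqr_ge0.
exists (sqnorm e + \sum_k complex.Re (`|b k| ^+ 2)) => X KX.
apply: (@le_trans _ _ (sqnorm (X *m e))).
  rewrite /sqnorm (bigD1 i) //= -colE mxE lerDl.
  by apply: sumr_ge0 => k _; apply: pos.
apply: KX => [|A SA]; first by rewrite lerDl sumr_ge0 // => k _; apply: pos.
rewrite -[leLHS]add0r lerD //; first by rewrite sumr_ge0.
apply: ler_sum => k _; rewrite -colE mxE.
have : `|A k j| ^+ 2 <= `|b k| ^+ 2.
  rewrite lerXn2r ?nnegrE // (le_trans (bP k _ SA)) //.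
  by rewrite real_ler_norm // ger0_real // (le_trans _ (bP k _ SA)).
by rewrite lecE => /andP [].
Qed.

(** The dominated matrices form a compact set: a closed part of a product of
    segments, in the space of the real and imaginary parts of the entries. *)
Lemma dominated_max_det : exists2 X, dominated X &
  forall Y, dominated Y -> `|\det Y| <= `|\det X|.
Proof.
pose I := ('I_n * 'I_n * bool)%type.
pose T := prod_topology (fun _ : I => R).
pose mat (f : T) := \matrix_(i, j) (f (i, j, false) +i* f (i, j, true)).
pose enc (X : 'M[R[i]]_n) : T :=
  fun k => let z := X k.1.1 k.1.2 in if k.2 then complex.Im z else complex.Re z.
have encK X : mat (enc X) = X.
  by apply/matrixP => i j; rewrite mxE /enc /=; case: (X i j).
have mat_cont i j : ccontinuous (fun f => mat f i j).
  split=> f.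
    rewrite (_ : (fun f => _) = fun f : T => f (i, j, false)).
      exact: (@proj_continuous _ (fun _ : I => R) (i, j, false)).
    by apply/funext => g; rewrite mxE.
  rewrite (_ : (fun f => _) = fun f : T => f (i, j, true)).
    exact: (@proj_continuous _ (fun _ : I => R) (i, j, true)).
  by apply/funext => g; rewrite mxE.
pose K := mat @^-1` dominated.
have closedK : closed K.
  pose J := [set p : 'cV[R[i]]_n * R | sqnorm p.1 <= p.2 /\
               forall A, S A -> sqnorm (A *m p.1) <= p.2].
  have -> : K = \bigcap_(p in J) [set f | sqnorm (mat f *m p.1) <= p.2].
    apply/seteqP; split=> [f Kf [v M] [vM SM]|f Kf v M vM SM]; first exact: Kf.
    exact: (Kf (v, M)).
  apply: closed_bigI => - [v M] _ /=.
  apply: (@closed_comp _ _ (fun f => sqnorm (mat f *m v)) [set x | x <= M]).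
    move=> f _; apply: continuous_big; first exact: add_continuous.
    move=> k _; apply: continuous_sqr_norm.
    rewrite (_ : (fun g => _) = fun g => \sum_l mat g k l * v l 0).
      apply: ccontinuous_sum => l.
      by apply: ccontinuousM; [exact: mat_cont|exact: ccontinuous_cst].
    by apply/funext => g; rewrite mxE.
  exact: closed_le.
have [c cP] :=
  choice (fun p : 'I_n * 'I_n => dominated_bounded p.1 p.2).
have compactK : compact K.
  pose box (k : I) := `[- (1 + c k.1), 1 + c k.1]%classic : set R.
  apply: (subclosed_compact closedK (@tychonoff I (fun=> R) box _)).
    by move=> k; exact: segment_compact.
  have small (x y : R) : x ^+ 2 <= y -> - (1 + y) <= x <= 1 + y.
    by move=> xy; apply/andP; split; nra.
  move=> f Kf [[i j] b]; rewrite /box /= in_itv /=; apply: small.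
  have := cP (i, j) _ Kf; rewrite -add_Re2_Im2 /= mxE /=.
  by case: b => h; nra.
pose g f := complex.Re (`|\det (mat f)| ^+ 2).
have [|||f] := @compact_EVT_max T R g K.
- by exists (enc 1%:M); rewrite /K /= encK; exact: dominated1.
- exact: compactK.
- by apply: continuous_subspaceT; apply: continuous_sqr_norm; exact: ccontinuous_det.
rewrite inE => Kf fmax; exists (mat f) => // Y KY.
have : g (enc Y) <= g f by apply: fmax; rewrite inE /K /= encK.
rewrite /g encK -lecR !RRe_real ?rpredX ?normr_real //.
by rewrite ler_pXn2r ?nnegrE.
Qed.

(** A John ellipsoid argument. Let [X] be dominated with [|det X|] maximal. For
    [A] in [S], [X A] is dominated with a determinant of the same modulus, so
    by strict concavity it has the same Gram matrix as [X]; this says that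
    [X A X^-1] is unitary. *)
Lemma unitarisable : exists2 X, X \in unitmx &
  forall A, S A -> X *m A *m invmx X \is unitarymx.
Proof.
have [X KX maxX] := dominated_max_det.
have uX : X \in unitmx.
  rewrite unitmxE unitfE -normr_gt0.
  by have := maxX _ dominated1; rewrite det1 normr1; exact: lt_le_trans.
exists X => // A SA; have KXA := dominatedM KX SA.
have dXA : `|\det (X *m A)| = `|\det X|.
  by rewrite det_mulmx normrM (detS SA) mulr1.
case: (gram_midpoint uX dXA) => [XA|[Z [ZE ltZ]]]; last first.
  by have := maxX _ (dominated_midpoint KX KXA ZE); rewrite (lt_geF ltZ).
have gramM (P Q : 'M[R[i]]_n) :
    (P *m Q) ^t* *m (P *m Q) = Q ^t* *m (P ^t* *m P) *m Q.
  by rewrite trmxC_mul !mulmxA.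
apply/unitarymxP/mulmx1C; rewrite gramM XA -gramM mulmxV // trmx1 map_mx1.
by rewrite mul1mx.
Qed.

End Unitarisation.

(** * Composition flags and adapted bases *)

Section Flag.
Variables (R : realType) (n : nat) (S : set 'M[R[i]]_n).
Local Notation vs := {vspace 'cV[R[i]]_n}.

Definition composition_flag (k : nat) (U : vs) (W : nat -> vs) : Prop :=
  [/\ W 0%N = U, W k = fullv, forall m, invariant_subspace S (W m),
      forall m, (m < k)%N -> (W m <= W m.+1)%VS /\ W m.+1 <> W m &
      forall m (V : vs), (m < k)%N -> invariant_subspace S V ->
        (W m <= V)%VS -> (V <= W m.+1)%VS -> V = W m \/ V = W m.+1].

Lemma exists_composition_flag : exists k W, composition_flag k 0%VS W.
Proof.
have inv0 : invariant_subspace S 0%VS.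
  by move=> A _ v; rewrite memv0 => /eqP ->; rewrite mulmx0 mem0v.
suff: forall d (U : vs), invariant_subspace S U ->
    (\dim {:'cV[R[i]]_n} <= \dim U + d)%N ->
    exists k W, composition_flag k U W.
  by apply; [exact: inv0|exact: leq_addl].
have full (U : vs) : (\dim {:'cV[R[i]]_n} <= \dim U)%N -> U = fullv.
  by move=> dU; apply/eqP; rewrite eqEdim subvf.
elim=> [|d IH] U invU dU.
  by exists 0%N, (fun=> U); split=> //; apply: full; rewrite addn0 in dU.
have [->|Uf] := eqVneq U fullv.
  by exists 0%N, (fun=> fullv); split=> // m A _ v _; rewrite memvf.
(* the next member of the flag has least dimension among the invariant
   subspaces strictly above U *)
pose Q k := `[< exists V : vs,
  [/\ invariant_subspace S V, (U <= V)%VS, V <> U & \dim V = k] >].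
have exQ : exists k, Q k.
  exists (\dim {:'cV[R[i]]_n}); apply/asboolP; exists fullv; split=> //.
  - by move=> A _ v _; rewrite memvf.
  - exact: subvf.
  - by move=> fU; rewrite fU eqxx in Uf.
have [_ /asboolP[V [invV UV VU <-]] minV] := ex_minnP exQ.
have ltUV : (\dim U < \dim V)%N.
  by rewrite ltnNge; apply/negP => h; apply/VU/esym/eqP; rewrite eqEdim UV.
have [|k [W [W0 Wk invW incW irrW]]] := IH V invV.
  by apply: leq_trans dU _; rewrite addnS -addSn leq_add2r.
exists k.+1, (fun m => if m is m'.+1 then W m' else U); split=> // [[|m]|[|m]|[|m] X].
- exact: invU.
- exact: invW.
- by rewrite W0.
- exact: incW.
- rewrite W0 => _ invX UX XV; have [->|XU] := eqVneq X U; first by left.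
  right; apply/eqP; rewrite eqEdim XV; apply: minV; apply/asboolP.
  by exists X; split=> //; apply/eqP.
- exact: irrW.
Qed.

End Flag.

Definition basis_mx (K : fieldType) n (U : {vspace 'cV[K]_n}) :
  'M[K]_(n, \dim U) := \matrix_(a, b) (vbasis U)`_b a 0.

Lemma basis_mxE (K : fieldType) n (U : {vspace 'cV[K]_n}) (y : 'cV_(\dim U)) :
  basis_mx U *m y = \sum_b y b 0 *: (vbasis U)`_b.
Proof.
apply/colP => a; rewrite mxE summxE; apply: eq_bigr => b _.
by rewrite !mxE mulrC.
Qed.

Lemma basis_mx_mem (K : fieldType) n (U : {vspace 'cV[K]_n}) (y : 'cV_(\dim U)) :
  basis_mx U *m y \in U.
Proof.
rewrite basis_mxE rpred_sum // => b _; apply/rpredZ/vbasis_mem/mem_nth.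
by rewrite size_tuple.
Qed.

Lemma basis_mx_span (K : fieldType) n (U : {vspace 'cV[K]_n}) v :
  v \in U -> exists y, v = basis_mx U *m y.
Proof.
move=> vU; exists (\col_b coord (vbasis U) b v).
by rewrite basis_mxE {1}(coord_vbasis vU); apply: eq_bigr => b _; rewrite mxE.
Qed.

Lemma mulmx_cV_inj (K : fieldType) m n (A B : 'M[K]_(m, n)) :
  (forall y : 'cV_n, A *m y = B *m y) -> A = B.
Proof.
move=> AB; apply/matrixP => i j.
by have /colP/(_ i) := AB (delta_mx j 0); rewrite -!colE !mxE.
Qed.

(** Stated with [n] and [m] apart because [m] will be a sum of block sizes. *)
Lemma two_sided_inverse (K : fieldType) n m (P : 'M[K]_(n, m)) : n = m ->
  (forall v : 'cV_n, exists c, v = P *m c) ->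
  exists Q, P *m Q = 1%:M /\ Q *m P = 1%:M.
Proof.
move=> nm; subst m => surj.
have [c cP] := choice (fun j => surj (delta_mx j 0)).
pose Q := \matrix_(i, j) c j i 0.
have PQ : P *m Q = 1%:M.
  apply: mulmx_cV_inj => y; rewrite -mulmxA mul1mx.
  have -> : Q *m y = \sum_j y j 0 *: c j.
    apply/colP => a; rewrite mxE summxE; apply: eq_bigr => b _.
    by rewrite !mxE mulrC.
  rewrite mulmx_sumr [RHS]matrix_sum_delta; apply: eq_bigr => j _.
  by rewrite big_ord1 -scalemxAr -cP.
by exists Q; split=> //; apply: mulmx1C.
Qed.

Lemma submxblock_scalar (K : pzSemiRingType) k (p : 'I_k -> nat) (a : K)
    (i j : 'I_k) : i != j -> submxblock (a%:M : 'M_(\sum_i p i)) i j = 0.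
Proof. by move=> ij; rewrite -mxdiagZ mxblockK (negPf ij). Qed.

Lemma submxblock_scalar_diag (K : pzSemiRingType) k (p : 'I_k -> nat) (a : K)
    (i : 'I_k) : submxblock (a%:M : 'M_(\sum_i p i)) i i = a%:M.
Proof. by rewrite -mxdiagZ submxblock_diag. Qed.

Section Blocks.
Variables (R : realType) (n : nat) (S : set 'M[R[i]]_n).

(** [B j] is a basis of a complement of [W j] in [W j.+1], and the [C j] are the
    blocks of rows of the inverse of the matrix with blocks of columns [B j].
    The subspace [W m] is then cut out by the [C j] with [m <= j], and
    [C i *m A *m B j] is the [(i, j)] block of [A] in the new basis. *)
Lemma adapted_blocks : exists k (p : 'I_k -> nat)
    (B : forall j, 'M[R[i]]_(n, p j)) (C : forall j, 'M[R[i]]_(p j, n))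
    (W : nat -> {vspace 'cV[R[i]]_n}),
  [/\ n = (\sum_j p j)%N, forall j, (0 < p j)%N,
      [/\ \sum_j B j *m C j = 1%:M, forall j, C j *m B j = 1%:M &
          forall i j, i != j -> C i *m B j = 0],
      (forall m, (m <= k)%N -> forall v,
         v \in W m <-> (forall j : 'I_k, (m <= j)%N -> C j *m v = 0)) &
      (forall m, invariant_subspace S (W m)) /\
      (forall (j : 'I_k) (U : {vspace 'cV[R[i]]_n}),
         invariant_subspace S U ->
         (W j <= U)%VS -> (U <= W j.+1)%VS -> U = W j \/ U = W j.+1)].
Proof.
have [k [W [W0 Wk invW incW irrW]]] := exists_composition_flag S.
pose p (j : 'I_k) := \dim (W j.+1 :\: W j)%VS.
pose B j : 'M[R[i]]_(n, p j) := basis_mx (W j.+1 :\: W j)%VS.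
have dimW m : (m < k)%N ->
    \dim (W m.+1) = (\dim (W m) + \dim (W m.+1 :\: W m)%VS)%N.
  move=> /incW [/capv_idPr WW _].
  by rewrite -(dimv_cap_compl (W m.+1) (W m)) WW.
have sum_dim m : (m <= k)%N -> \dim (W m) = (\sum_(j < k | (j < m)%N) p j)%N.
  elim: m => [|m IH] mk; first by rewrite W0 dimv0 big_pred0.
  rewrite (dimW m mk) (IH (ltnW mk)).
  rewrite [RHS](bigD1 (Ordinal mk)); last by rewrite /= ltnSn.
  rewrite addnC; congr (_ + _)%N.
  apply: eq_bigl => j; rewrite ltnS -val_eqE /= [in RHS]leq_eqVlt.
  by case: ltngtP.
have np : n = (\sum_j p j)%N.
  have := sum_dim k (leqnn k); rewrite Wk dimvf /dim /= muln1 => ->.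
  by apply: eq_bigl => j; rewrite ltn_ord.
pose P := \mxrow_j B j.
have WP m : (m <= k)%N -> forall v, v \in W m ->
    exists c, v = P *m c /\ forall j : 'I_k, (m <= j)%N -> submxcol c j = 0.
  elim: m => [|m IH] mk v.
    rewrite W0 memv0 => /eqP ->; exists 0; rewrite mulmx0; split=> // j _.
    exact: submxcol0.
  have [Wm _] := incW m mk; have := addv_diff_cap (W m.+1) (W m).
  rewrite (capv_idPr Wm) => <- /memv_addP [w + [u /(IH (ltnW mk)) [c [-> c0]] ->]].
  move=> /basis_mx_span [y ->].
  (* [E] embeds the coordinates of block [m] into those of the whole space *)
  pose E := submxrow (1%:M : 'M[R[i]]_(\sum_j p j)) (Ordinal mk).
  exists (E *m (y : 'cV_(p (Ordinal mk))) + c); split.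
    by rewrite mulmxDr mulmxA mul_submxrow mulmx1 mxrowK.
  move=> j mj; rewrite submxcolD (c0 j (ltnW mj)) addr0 -submxcol_mul -submxblockEh.
  by rewrite submxblock_scalar ?mul0mx // -val_eqE /= gtn_eqF.
have [|Q [PQ QP]] := two_sided_inverse np (P := P).
  by move=> v; have [|c [-> _]] := WP k (leqnn k) v; [rewrite Wk memvf|exists c].
pose C j := submxcol Q j.
have CB i j : C i *m B j = submxblock (1%:M : 'M_(\sum_j p j)) i j.
  by rewrite -QP submxblockEh -mul_submxrow -submxcol_mul mxrowK.
have BC : \sum_j B j *m C j = 1%:M by rewrite -mul_mxrow_mxcol submxcolK.
have leW m m' : (m <= m')%N -> (m' <= k)%N -> (W m <= W m')%VS.
  elim: m' => [|m' IH]; first by rewrite leqn0 => /eqP ->.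
  rewrite leq_eqVlt => /orP[/eqP ->//|]; rewrite ltnS => mm' m'k.
  by apply: subv_trans (IH mm' (ltnW m'k)) _; case: (incW m' m'k).
exists k, p, B, C, W; split=> //.
- move=> j; rewrite lt0n; apply/negP => /eqP pj0.
  have [WW] := incW j (ltn_ord j); apply; apply/esym/eqP.
  by rewrite eqEdim WW (dimW j (ltn_ord j)) -/(p j) pj0 addn0 leqnn.
- split=> // [j|i j ij]; rewrite CB.
    exact: submxblock_scalar_diag.
  exact: submxblock_scalar.
- move=> m mk v; split=> [/(WP m mk) [c [-> c0]] j mj|Cv].
    by rewrite mulmxA submxcol_mul QP submxcol_mul mul1mx c0.
  rewrite -[v]mul1mx -BC mulmx_suml rpred_sum // => j _.
  have [mj|jm] := leqP m j; first by rewrite -mulmxA Cv // mulmx0 mem0v.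
  rewrite -mulmxA; apply: (subvP (leW _ _ jm mk)).
  exact: (subvP (diffvSl _ _)) (basis_mx_mem _).
- by split=> // j U; apply: irrW.
Qed.

End Blocks.

(** * Properties inherited by the diagonal blocks *)

Section DiagonalBlocks.
Variables (R : realType) (n : nat) (S : set 'M[R[i]]_n).
Variables (k : nat) (p : 'I_k -> nat).
Variables (B : forall j, 'M[R[i]]_(n, p j)) (C : forall j, 'M[R[i]]_(p j, n)).
Variable W : nat -> {vspace 'cV[R[i]]_n}.
Hypothesis CB1 : forall j, C j *m B j = 1%:M.
Hypothesis CB0 : forall i j, i != j -> C i *m B j = 0.
Hypothesis memW : forall m, (m <= k)%N -> forall v,
  v \in W m <-> (forall j : 'I_k, (m <= j)%N -> C j *m v = 0).
Hypothesis invW : forall m, invariant_subspace S (W m).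

Lemma blockC_flag_eq0 (j : 'I_k) v : v \in W j -> C j *m v = 0.
Proof. by move/(memW (ltnW (ltn_ord j))); apply. Qed.

Lemma blockB_flag (j : 'I_k) (y : 'cV_(p j)) : B j *m y \in W j.+1.
Proof.
apply/memW => // l jl; rewrite mulmxA CB0 ?mul0mx //.
by rewrite -val_eqE /= gtn_eqF.
Qed.

(** Modulo [W j], the action of [A] on [W j.+1] is that of its diagonal block. *)
Lemma block_remainder_flag A (j : 'I_k) (y : 'cV_(p j)) : S A ->
  A *m (B j *m y) - B j *m ((C j *m A *m B j) *m y) \in W j.
Proof.
move=> SA; apply/memW => [|l jl]; first exact/ltnW.
rewrite mulmxBr; move: jl; rewrite leq_eqVlt => /orP[/eqP/val_inj <-|jl].
  by rewrite [C j *m (B j *m _)]mulmxA CB1 mul1mx !mulmxA subrr.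
have /memW -> // := invW SA (blockB_flag y).
by rewrite [C l *m _]mulmxA CB0 ?mul0mx ?subr0 // -val_eqE /= gtn_eqF.
Qed.

Lemma block_below_diagonal A (i j : 'I_k) :
  S A -> (j < i)%N -> C i *m A *m B j = 0.
Proof.
move=> SA ji; apply: mulmx_cV_inj => y; rewrite mul0mx -!mulmxA.
by have /memW -> := invW SA (blockB_flag y).
Qed.

Lemma diagonal_blockM A A' (j : 'I_k) : S A -> S A' ->
  C j *m (A *m A') *m B j = C j *m A *m B j *m (C j *m A' *m B j).
Proof.
move=> SA SA'; apply: mulmx_cV_inj => y; apply/eqP; rewrite -subr_eq0.
have := blockC_flag_eq0 (invW SA (block_remainder_flag y SA')).
by rewrite !mulmxBr !mulmxA => ->.
Qed.

(** An invariant subspace [X] of the block yields the invariant subspace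
    [W j + B j X] of [S], which lies between [W j] and [W j.+1]. *)
Lemma diagonal_block_irreducible (j : 'I_k) :
  (forall U : {vspace 'cV[R[i]]_n}, invariant_subspace S U ->
     (W j <= U)%VS -> (U <= W j.+1)%VS -> U = W j \/ U = W j.+1) ->
  irreducible [set C j *m A *m B j | A in S].
Proof.
move=> irrW X invX.
pose f := linfun (mulmx (B j) : 'cV[R[i]]_(p j) -> 'cV[R[i]]_n).
have WjW : (W j <= W j.+1)%VS.
  apply/subvP => v /memW Wv; apply/memW => // l jl.
  by apply: Wv; rewrite ltnW.
have [|||WX|WX] := irrW (W j + f @: X)%VS.
- move=> A SA _ /memv_addP [u uW [_ /memv_imgP [x xX ->] ->]].
  rewrite lfunE mulmxDr /=.
  rewrite -[A *m (B j *m x)](subrK (B j *m ((C j *m A *m B j) *m x))).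
  rewrite addrA memv_add //.
    by rewrite rpredD ?block_remainder_flag //; apply: invW.
  apply/memv_imgP; exists ((C j *m A *m B j) *m x); rewrite ?lfunE //.
  by apply: invX => //; exists A.
- exact: addvSl.
- rewrite subv_add WjW; apply/subvP => _ /memv_imgP [x _ ->].
  by rewrite lfunE; apply: blockB_flag.
- left; apply/eqP; rewrite -subv0; apply/subvP => x xX; rewrite memv0.
  have : B j *m x \in W j.
    rewrite -WX; apply: (subvP (addvSr _ _)).
    by apply/memv_imgP; exists x; rewrite ?lfunE.
  by move=> /blockC_flag_eq0; rewrite mulmxA CB1 mul1mx => ->.
- right; apply/eqP; rewrite eqEsubv subvf; apply/subvP => x _.
  have := blockB_flag x; rewrite -WX => /memv_addP [u uW [_ /memv_imgP [y yX ->] E]].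
  have := congr1 (mulmx (C j)) E; rewrite mulmxDr lfunE /= !mulmxA CB1 !mul1mx.
  by rewrite (blockC_flag_eq0 uW) add0r => ->.
Qed.

(** If [A - z] is invertible, it maps the invariant subspace [W j] onto itself,
    so it is still injective on [W j.+1] modulo [W j], where the block acts. *)
Lemma diagonal_block_eigenvalue A (j : 'I_k) z : S A ->
  eigenvalue (C j *m A *m B j) z -> eigenvalue A z.
Proof.
move=> SA /eigenvalue_columnP [y y0 Dy]; apply/eigenvalue_det/eqP/negPn/negP => dM.
pose M := A - z%:M.
have uM : M \in unitmx by rewrite unitmxE unitfE.
pose f := linfun (mulmx M : 'cV[R[i]]_n -> 'cV[R[i]]_n).
have fE v : f v = M *m v by rewrite lfunE.
have fW : (f @: W j = W j)%VS.
  apply/eqP; rewrite eqEdim; apply/andP; split.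
    apply/subvP => _ /memv_imgP [v vW ->]; rewrite fE mulmxBl mul_scalar_mx.
    by rewrite rpredB ?rpredZ //; apply: invW.
  rewrite limg_dim_eq //; apply/eqP; rewrite -subv0; apply/subvP => v.
  rewrite memv_cap memv_ker fE => /andP [_ /eqP Mv].
  by rewrite -(mulKmx uM v) Mv mulmx0 mem0v.
have : M *m (B j *m y) \in W j.
  by have := block_remainder_flag y SA; rewrite Dy mulmxBl mul_scalar_mx -scalemxAr.
rewrite -fW => /memv_imgP [u uW]; rewrite fE => /(can_inj (mulKmx uM)) Bu.
move: uW; rewrite -Bu => /blockC_flag_eq0.
by rewrite mulmxA CB1 mul1mx => yz; rewrite yz eqxx in y0.
Qed.

End DiagonalBlocks.

(** * Irreducible blocks are multiples of unitaries *)

Section Assembly.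
Variables (R : realType) (m : nat).

Lemma conjugate_irreducible_semigroup (D : set 'M[R[i]]_m) X : X \in unitmx ->
  irreducible_semigroup D ->
  irreducible_semigroup [set X *m A *m invmx X | A in D].
Proof.
move=> uX [sgD irrD]; split.
  move=> _ _ [A DA <-] [A' DA' <-]; exists (A *m A'); first exact: sgD.
  by rewrite !mulmxA mulmxKV.
move=> W invW.
pose f := linfun (mulmx (invmx X) : 'cV[R[i]]_m -> 'cV[R[i]]_m).
have fW v : (invmx X *m v \in f @: W)%VS = (v \in W).
  apply/memv_imgP/idP => [[w wW]|vW]; last by exists v; rewrite ?lfunE.
  by rewrite lfunE => /(can_inj (mulKVmx uX)) ->.
have [|fW0|fWf] := irrD (f @: W)%VS.
- move=> A DA _ /memv_imgP [w wW ->]; rewrite lfunE /=.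
  rewrite -[X in X \in _](mulKmx uX) fW !mulmxA.
  by apply: invW => //; exists A.
- left; apply/eqP; rewrite -subv0; apply/subvP => v.
  by rewrite -fW fW0 !memv0 => /eqP h; rewrite -(mulKVmx uX v) h mulmx0.
- right; apply/eqP; rewrite eqEsubv subvf; apply/subvP => v _.
  by rewrite -fW fWf memvf.
Qed.

Lemma irreducible_circular_unitary (D : set 'M[R[i]]_m) : (1 < m)%N ->
  irreducible_semigroup D ->
  (forall A, D A -> exists2 r : R, 0 <= r &
     spectrum A `<=` [set r%:C * z | z in unit_circle R]) ->
  exists2 X, X \in unitmx & forall A, D A ->
    X *m A *m invmx X = 0 \/
    exists (r : R) U,
      [/\ 0 < r, U \is unitarymx & X *m A *m invmx X = r%:C *: U].
Proof.
move=> m1 irrD specD.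
have [|A []//|i j|X uX unitX] := @unitarisable R m (normalised D).
- exact: normalised_semigroup.
- exact: normalised_bounded.
exists X => // A /(normalisedP m1 irrD specD) [->|[r [U [r0 NU ->]]]].
  by left; rewrite mulmx0 mul0mx.
right; exists r, (X *m U *m invmx X); split=> //; first exact: unitX.
by rewrite -scalemxAr -scalemxAl.
Qed.

(** [Su] consists of the unitary parts of the nonzero members of [D]. It has the
    same invariant subspaces as [D]. *)
Lemma unitary_multiples_form (D : set 'M[R[i]]_m) : (1 < m)%N ->
  irreducible_semigroup D ->
  (forall A, D A -> A = 0 \/
     exists (r : R) U, [/\ 0 < r, U \is unitarymx & A = r%:C *: U]) ->
  exists Su : set 'M[R[i]]_m,
    [/\ irreducible_semigroup Su, forall U, Su U -> U \is unitarymx &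
        nonneg_form D Su].
Proof.
move=> m1 [sgD irrD] formD.
pose Su := [set U : 'M[R[i]]_m |
  U \is unitarymx /\ exists2 r : R, 0 < r & D (r%:C *: U)].
have SuP A : D A ->
    A = 0 \/ exists (r : R) U, [/\ 0 < r, Su U & A = r%:C *: U].
  move=> DA; have [->|[r [U [r0 uU AE]]]] := formD A DA; first by left.
  by right; exists r, U; split=> //; split=> //; exists r; rewrite // -AE.
have irrSu : irreducible Su.
  move=> W invW; apply: irrD => A /SuP [-> v _|[r [U [_ SuU ->]]] v vW].
    by rewrite mul0mx mem0v.
  by rewrite -scalemxAl rpredZ //; apply: invW.
(* needed to write the zero matrix as a multiple of a member of Su *)
have [U0 SuU0] : exists U, Su U.
  apply/not_existsP => noSu; pose u : 'cV[R[i]]_m := const_mx 1.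
  have [|/eqP|E] := irrSu <[u]>%VS.
  - by move=> U /noSu.
  - rewrite -dimv_eq0 dim_vline.
    suff -> : u != 0 by [].
    apply/eqP => /matrixP /(_ (Ordinal (ltnW m1)) 0).
    by rewrite !mxE => /eqP; rewrite oner_eq0.
  - have : (\dim <[u]> <= 1)%N by rewrite dim_vline leq_b1.
    by rewrite E dimvf /dim /= muln1 leqNgt m1.
exists Su; split=> [|U []//|].
  split=> // U V [uU [r r0 DU]] [uV [s s0 DV]]; split; first exact: mul_unitarymx.
  exists (r * s); first exact: mulr_gt0.
  rewrite rmorphM -scalerA.
  by have := sgD _ _ DU DV; rewrite -scalemxAl -scalemxAr.
apply/seteqP; split=> [_ [r [A [r0 /SuP DA ->]]]|_ [r [U [r0 [uU [s s0 DU]] ->]]]].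
  case: DA => [->|[s [U [s0 SuU ->]]]].
    by exists 0, U0; split; rewrite ?scaler0 ?scale0r.
  by exists (r * s), U; split; rewrite ?rmorphM ?scalerA // mulr_ge0 // ltW.
exists (r / s), (s%:C *: U); split; rewrite ?divr_ge0 ?(ltW s0) //.
by rewrite scalerA -rmorphM divfK // gt_eqF.
Qed.

End Assembly.

Unset Implicit Arguments.

Theorem theorem2p3 (R : realType) (n : nat) (hn : (1 < n)%N)
    (S : set 'M[R[i]]_n) (hS : matrix_semigroup S)
    (hspec : forall A, S A ->
       exists2 r : R, 0 <= r &
         spectrum A `<=` [set r%:C * z | z in unit_circle R]) :
  exists (P : 'M[R[i]]_n) (k : nat) (p : 'I_k -> nat)
         (e : n = (\sum_(i < k) p i)%N),
    [/\ P \in unitmx,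
        forall i, (0 < p i)%N,
        block_upper_triangular p (cast_set e (conjugate_by P S)) &
        forall i, (1 < p i)%N ->
          let B := diagonal_block p (cast_set e (conjugate_by P S)) i in
          irreducible_semigroup B /\
          exists Su : set 'M[R[i]]_(p i),
            [/\ irreducible_semigroup Su,
                forall U, Su U -> U \is unitarymx &
                nonneg_form B Su]].
Proof.
have [k [p [B [C [W [np p0 [BC CB1 CB0] memW [invW irrW]]]]]]] := adapted_blocks S.
pose D j := [set C j *m A *m B j | A in S].
have irrD j : irreducible_semigroup (D j).
  split; last exact: (diagonal_block_irreducible CB1 CB0 memW invW (@irrW j)).
  move=> _ _ [A SA <-] [A' SA' <-]; exists (A *m A'); first exact: hS.
  exact: (diagonal_blockM CB1 CB0 memW invW).
have specD j M : D j M -> exists2 r : R, 0 <= r &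
    spectrum M `<=` [set r%:C * z | z in unit_circle R].
  move=> [A SA <-]; have [r r0 sA] := hspec A SA; exists r => // z ez.
  exact/sA/(diagonal_block_eigenvalue CB1 CB0 memW invW SA ez).
have [X XP] : exists X : forall j, 'M[R[i]]_(p j), forall j,
    X j \in unitmx /\ ((1 < p j)%N -> forall M, D j M ->
      X j *m M *m invmx (X j) = 0 \/ exists (r : R) U,
        [/\ 0 < r, U \is unitarymx & X j *m M *m invmx (X j) = r%:C *: U]).
  suff h j : exists Y, Y \in unitmx /\ ((1 < p j)%N -> forall M, D j M ->
      Y *m M *m invmx Y = 0 \/ exists (r : R) U,
        [/\ 0 < r, U \is unitarymx & Y *m M *m invmx Y = r%:C *: U]).
    by exists (fun j => sval (cid (h j))) => j; exact: svalP (cid (h j)).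
  have [pj|pj] := ltnP 1 (p j); last by exists 1%:M; rewrite unitmx1.
  have [Y uY YD] := irreducible_circular_unitary pj (irrD j) (@specD j).
  by exists Y.
have uX j : X j \in unitmx by case: (XP j).
subst n.
pose P := \mxrow_j (B j *m invmx (X j)).
pose Q := \mxcol_j (X j *m C j).
have PQ : P *m Q = 1%:M.
  rewrite mul_mxrow_mxcol -BC; apply: eq_bigr => j _.
  by rewrite mulmxA mulmxKV.
have uP : P \in unitmx by case: (mulmx1_unit PQ).
have QE : invmx P = Q by rewrite -[RHS](mulKmx uP) PQ mulmx1.
have blockE A i j : submxblock (invmx P *m A *m P) i j =
    X i *m (C i *m A *m B j) *m invmx (X j).
  rewrite QE /Q mxcol_mul mul_mxcol_mxrow mxblockK.
  by rewrite !mulmxA.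
exists P, k, p, erefl.
have castE : cast_set erefl (conjugate_by P S) = conjugate_by P S.
  apply/seteqP; split=> [_ [A SA <-]|A SA]; first by rewrite castmx_id.
  by exists A; rewrite ?castmx_id.
rewrite castE; split=> // [_ [A SA <-] i j ji|j pj].
  by rewrite blockE (block_below_diagonal CB0 memW invW) // mulmx0 mul0mx.
have -> : diagonal_block p (conjugate_by P S) j =
    [set X j *m M *m invmx (X j) | M in D j].
  apply/seteqP; split=> [_ [_ [A SA <-] <-]|_ [_ [A SA <-] <-]].
    by rewrite blockE; exists (C j *m A *m B j) => //; exists A.
  by exists (invmx P *m A *m P); [exists A|rewrite blockE].
have irrE := conjugate_irreducible_semigroup (uX j) (irrD j).
split=> //; apply: unitary_multiples_form => // _ [M DM <-].
by case: (XP j) => _; apply.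
Qed.
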